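(* Let $L$ be the Lie ring (over $\mathbb Z$) with presentation \[ \begin{aligned} L=\langle x_1,x_2,x_3,x_4\mid{}& 4x_1+2[x_4,x_3]+[x_4,x_2],\\ &16x_2+4[x_4,x_3]-[x_4,x_1],\\ &64x_3-4[x_4,x_2]-2[x_4,x_1]\rangle , \end{aligned} \] and set $a:=32[x_1,x_2]+64[x_1,x_3]+128[x_2,x_3]\in L$. Then $a\in\delta_4(L)\setminus\gamma_4(L)$.
   Context: A presentation $\langle X\mid \mathscr R\rangle$ of a Lie ring denotes the quotient of the free Lie ring over $\mathbb Z$ on $X$ by the Lie ideal generated by $\mathscr R$. The lower central series of a Lie ring $L$ is $\gamma_1(L)=L$ and, for $n\ge 1$, $\gamma_{n+1}(L)$ is the additive subgroup generated by all $[x,y]$ with $x\in L$, $y\in\gamma_n(L)$. $\mathscr U(L)$ is the universal enveloping algebra of $L$ over $\mathbb Z$, $\iota:L\to\mathscr U(L)$ is the natural map (injective over $\mathbb Z$), and $\varpi(L)$ is the augmentation ideal of $\mathscr U(L)$, i.e. the two-sided ideal generated by $\iota(L)$; $\varpi^n(L)$ is its $n$th power. The $n$th Lie dimension subring is $\delta_n(L)=L\cap\varpi^n(L)=\{x\in L:\iota(x)\in\varpi^n(L)\}$, $n\ge1$. *)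

(* Defs.v *)
From HB Require Import structures.
From mathcomp Require Import all_boot all_algebra.
From mathcomp Require Import boolp classical_sets.

Set Implicit Arguments.
Unset Strict Implicit.
Unset Printing Implicit Defensive.

Import GRing.Theory.
Local Open Scope ring_scope.
Local Open Scope quotient_scope.
Local Open Scope classical_set_scope.

Reserved Notation "⁅ x , y ⁆" (at level 0, x, y at level 99,
  format "⁅ x ,  y ⁆").

HB.mixin Record isLieRing L of GRing.Zmodule L := {
  lie : L -> L -> L;
  lieDl : left_distributive lie +%R;
  lieDr : right_distributive lie +%R;
  liexx : forall x, lie x x = 0;
  lie_jacobi : forall x y z,
    lie x (lie y z) + lie y (lie z x) + lie z (lie x y) = 0
}.

#[short(type="lieRingType")]
HB.structure Definition LieRing := {L of GRing.Zmodule L & isLieRing L}.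

Notation "⁅ x , y ⁆" := (lie x y) : ring_scope.

Section LieRingTheory.
Variable L : lieRingType.
Implicit Types x y z : L.

Lemma lieC x y : ⁅x, y⁆ = - ⁅y, x⁆.
Proof.
apply/eqP; rewrite -addr_eq0; apply/eqP.
by have := liexx (x + y); rewrite lieDl !lieDr !liexx add0r addr0.
Qed.

Lemma lie0r x : ⁅0, x⁆ = 0.
Proof. by apply: (addrI ⁅0, x⁆); rewrite -lieDl !addr0. Qed.

Lemma lier0 x : ⁅x, 0⁆ = 0.
Proof. by rewrite lieC lie0r oppr0. Qed.

Lemma lieNr x y : ⁅x, - y⁆ = - ⁅x, y⁆.
Proof. by apply: (addrI ⁅x, y⁆); rewrite -lieDr !subrr lier0. Qed.

Lemma lieBr x y z : ⁅x, y - z⁆ = ⁅x, y⁆ - ⁅x, z⁆.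
Proof. by rewrite lieDr lieNr. Qed.

Lemma lieBl x y z : ⁅x - y, z⁆ = ⁅x, z⁆ - ⁅y, z⁆.
Proof. by rewrite lieC lieBr opprB addrC -lieC -[- ⁅z, x⁆]lieC. Qed.

End LieRingTheory.

Definition lie_morphism (L M : lieRingType) (f : L -> M) : Prop :=
  zmod_morphism f /\ {morph f : x y / ⁅x, y⁆ >-> ⁅x, y⁆}.

Inductive zspan (V : zmodType) (S : set V) : set V :=
| zspan_mem x : S x -> zspan S x
| zspan0 : zspan S 0
| zspanB x y : zspan S x -> zspan S y -> zspan S (x - y).

(* Closure under brackets on one side suffices, by antisymmetry. *)
Inductive lie_ideal (L : lieRingType) (S : set L) : set L :=
| lie_ideal_mem x : S x -> lie_ideal S x
| lie_ideal0 : lie_ideal S 0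
| lie_idealB x y : lie_ideal S x -> lie_ideal S y -> lie_ideal S (x - y)
| lie_ideal_lie x y : lie_ideal S y -> lie_ideal S ⁅x, y⁆.

Inductive ring_ideal (R : pzRingType) (S : set R) : set R :=
| ring_ideal_mem x : S x -> ring_ideal S x
| ring_ideal0 : ring_ideal S 0
| ring_idealB x y : ring_ideal S x -> ring_ideal S y -> ring_ideal S (x - y)
| ring_idealMl x y : ring_ideal S y -> ring_ideal S (x * y)
| ring_idealMr x y : ring_ideal S x -> ring_ideal S (x * y).

(* The index 0, which is not used in the mathematics, gives the whole ring. *)
Fixpoint lower_central (L : lieRingType) (n : nat) : set L :=
  match n with
  | 0 => setT
  | 1 => setT
  | m.+1 => zspan [set z | exists x y, lower_central m y /\ z = ⁅x, y⁆]
  end.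
Arguments lower_central : clear implicits.

Fixpoint ideal_pow (R : pzRingType) (I : set R) (n : nat) : set R :=
  match n with
  | 0 => setT
  | 1 => I
  | m.+1 => zspan [set z | exists x y, [/\ I x, ideal_pow I m y & z = x * y]]
  end.

Section FreeLieRing.
Variable X : Type.

Inductive lie_term :=
| LVar of X
| LZero
| LOpp of lie_term
| LAdd of lie_term & lie_term
| LLie of lie_term & lie_term.

HB.instance Definition _ := gen_eqMixin lie_term.
HB.instance Definition _ := gen_choiceMixin lie_term.

Inductive lie_term_eq : lie_term -> lie_term -> Prop :=
| lte_refl t : lie_term_eq t t
| lte_sym t u : lie_term_eq t u -> lie_term_eq u t
| lte_trans t u v : lie_term_eq t u -> lie_term_eq u v -> lie_term_eq t v
| lte_opp t t' : lie_term_eq t t' -> lie_term_eq (LOpp t) (LOpp t')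
| lte_add t t' u u' : lie_term_eq t t' -> lie_term_eq u u' ->
    lie_term_eq (LAdd t u) (LAdd t' u')
| lte_lie t t' u u' : lie_term_eq t t' -> lie_term_eq u u' ->
    lie_term_eq (LLie t u) (LLie t' u')
| lte_addA t u v : lie_term_eq (LAdd t (LAdd u v)) (LAdd (LAdd t u) v)
| lte_addC t u : lie_term_eq (LAdd t u) (LAdd u t)
| lte_add0 t : lie_term_eq (LAdd LZero t) t
| lte_addN t : lie_term_eq (LAdd (LOpp t) t) LZero
| lte_lieDl t u v :
    lie_term_eq (LLie (LAdd t u) v) (LAdd (LLie t v) (LLie u v))
| lte_lieDr t u v :
    lie_term_eq (LLie t (LAdd u v)) (LAdd (LLie t u) (LLie t v))
| lte_liexx t : lie_term_eq (LLie t t) LZero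
| lte_jacobi t u v :
    lie_term_eq (LAdd (LAdd (LLie t (LLie u v)) (LLie u (LLie v t)))
                      (LLie v (LLie t u))) LZero.

Definition lie_term_eqb : rel lie_term := fun t u => `[< lie_term_eq t u >].

Lemma lie_term_eqb_equiv : equiv_class_of lie_term_eqb.
Proof.
split=> [t|t u|u t v].
- exact/asboolP/lte_refl.
- by apply/asboolP/asboolP => /lte_sym.
- by move=> /asboolP tu /asboolP uv; apply/asboolP; apply: lte_trans tu uv.
Qed.

Canonical lie_term_equiv := EquivRelPack lie_term_eqb_equiv.

Definition free_lie : Type := {eq_quot lie_term_eqb}.

HB.instance Definition _ : EqQuotient _ lie_term_eqb free_lie :=
  EqQuotient.on free_lie.
HB.instance Definition _ := Choice.on free_lie.

Lemma free_lie_eqP t u : lie_term_eq t u <-> \pi_free_lie t = \pi_free_lie u.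
Proof.
split=> [tu|/eqP]; first by apply/eqP; rewrite piE; apply/asboolP.
by rewrite piE => /asboolP.
Qed.

Lemma free_lie_repr t : lie_term_eq (repr (\pi_free_lie t)) t.
Proof. by apply/free_lie_eqP; rewrite reprK. Qed.

Let fzero : free_lie := \pi_free_lie LZero.
Let fopp (x : free_lie) : free_lie := \pi_free_lie (LOpp (repr x)).
Let fadd (x y : free_lie) : free_lie := \pi_free_lie (LAdd (repr x) (repr y)).
Let flie (x y : free_lie) : free_lie := \pi_free_lie (LLie (repr x) (repr y)).

Let pi_opp t : fopp (\pi t) = \pi_free_lie (LOpp t).
Proof. exact/free_lie_eqP/lte_opp/free_lie_repr. Qed.
Let pi_add t u : fadd (\pi t) (\pi u) = \pi_free_lie (LAdd t u).
Proof. by apply/free_lie_eqP/lte_add; apply: free_lie_repr. Qed.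
Let pi_lie t u : flie (\pi t) (\pi u) = \pi_free_lie (LLie t u).
Proof. by apply/free_lie_eqP/lte_lie; apply: free_lie_repr. Qed.

Let faddA : associative fadd.
Proof.
by elim/quotW=> t; elim/quotW=> u; elim/quotW=> v; rewrite !pi_add;
  apply/free_lie_eqP/lte_addA.
Qed.
Let faddC : commutative fadd.
Proof.
by elim/quotW=> t; elim/quotW=> u; rewrite !pi_add;
  apply/free_lie_eqP/lte_addC.
Qed.
Let fadd0 : left_id fzero fadd.
Proof. by elim/quotW=> t; rewrite pi_add; apply/free_lie_eqP/lte_add0. Qed.
Let faddN : left_inverse fzero fopp fadd.
Proof.
by elim/quotW=> t; rewrite pi_opp pi_add; apply/free_lie_eqP/lte_addN.
Qed.

HB.instance Definition _ :=
  GRing.isZmodule.Build free_lie faddA faddC fadd0 faddN.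

Let flieDl : left_distributive flie fadd.
Proof.
by elim/quotW=> t; elim/quotW=> u; elim/quotW=> v;
  rewrite pi_add !pi_lie pi_add; apply/free_lie_eqP/lte_lieDl.
Qed.
Let flieDr : right_distributive flie fadd.
Proof.
by elim/quotW=> t; elim/quotW=> u; elim/quotW=> v;
  rewrite pi_add !pi_lie pi_add; apply/free_lie_eqP/lte_lieDr.
Qed.
Let fliexx x : flie x x = 0.
Proof.
by elim/quotW: x => t; rewrite pi_lie; apply/free_lie_eqP/lte_liexx.
Qed.
Let flie_jacobi x y z :
  fadd (fadd (flie x (flie y z)) (flie y (flie z x))) (flie z (flie x y)) = 0.
Proof.
elim/quotW: x => t; elim/quotW: y => u; elim/quotW: z => v.
rewrite (pi_lie u v) (pi_lie v t) (pi_lie t u) !pi_lie.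
rewrite (pi_add (LLie t _) (LLie u _)) pi_add.
exact/free_lie_eqP/lte_jacobi.
Qed.

HB.instance Definition _ :=
  isLieRing.Build free_lie flieDl flieDr fliexx flie_jacobi.

Definition free_lie_gen (x : X) : free_lie := \pi_free_lie (LVar x).

Lemma free_lie_zeroE : 0 = \pi_free_lie LZero. Proof. by []. Qed.
Lemma free_lie_oppE t : - \pi_free_lie t = \pi_free_lie (LOpp t).
Proof. exact: pi_opp. Qed.
Lemma free_lie_addE t u :
  \pi_free_lie t + \pi_free_lie u = \pi_free_lie (LAdd t u).
Proof. exact: pi_add. Qed.
Lemma free_lie_lieE t u :
  ⁅\pi_free_lie t, \pi_free_lie u⁆ = \pi_free_lie (LLie t u).
Proof. exact: pi_lie. Qed.

Section Lift.
Variables (M : lieRingType) (g : X -> M).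

Fixpoint lie_eval (t : lie_term) : M :=
  match t with
  | LVar x => g x
  | LZero => 0
  | LOpp t => - lie_eval t
  | LAdd t u => lie_eval t + lie_eval u
  | LLie t u => ⁅lie_eval t, lie_eval u⁆
  end.

Lemma lie_eval_eq t u : lie_term_eq t u -> lie_eval t = lie_eval u.
Proof.
elim=> //= *; do ?congruence.
- exact: addrA.
- exact: addrC.
- exact: add0r.
- exact: addNr.
- exact: lieDl.
- exact: lieDr.
- exact: liexx.
- exact: lie_jacobi.
Qed.

Definition free_lie_lift (x : free_lie) : M := lie_eval (repr x).

Lemma free_lie_liftE t : free_lie_lift (\pi t) = lie_eval t.
Proof. exact/lie_eval_eq/free_lie_repr. Qed.

Lemma free_lie_lift_morphism : lie_morphism free_lie_lift.
Proof.
split; elim/quotW=> t; elim/quotW=> u.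
  by rewrite free_lie_oppE free_lie_addE !free_lie_liftE.
by rewrite free_lie_lieE !free_lie_liftE.
Qed.

Lemma free_lie_lift_gen x : free_lie_lift (free_lie_gen x) = g x.
Proof. exact: free_lie_liftE. Qed.

Lemma free_lie_lift_unique (f : free_lie -> M) :
  lie_morphism f -> (forall x, f (free_lie_gen x) = g x) -> f =1 free_lie_lift.
Proof.
move=> [fB fL] fg; have f0 : f 0 = 0 by rewrite -(subrr 0) fB subrr.
have fN x : f (- x) = - f x by rewrite -sub0r fB f0 sub0r.
have fD x y : f (x + y) = f x + f y by rewrite -{1}[y]opprK fB fN opprK.
elim/quotW=> t; rewrite free_lie_liftE.
elim: t => [x||t IH|t IHt u IHu|t IHt u IHu] /=.
- exact: fg.
- exact: f0.
- by rewrite -free_lie_oppE fN IH.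
- by rewrite -free_lie_addE fD IHt IHu.
- by rewrite -free_lie_lieE fL IHt IHu.
Qed.

End Lift.

End FreeLieRing.

Section Presentation.
Variables (X : Type) (R : set (free_lie X)).

Definition relb : pred (free_lie X) := fun x => `[< lie_ideal R x >].

Lemma relb_zmod_closed : zmod_closed relb.
Proof.
split=> [|x y /asboolP Rx /asboolP Ry]; apply/asboolP.
  exact: lie_ideal0.
exact: lie_idealB.
Qed.

HB.instance Definition _ :=
  GRing.isZmodClosed.Build (free_lie X) relb relb_zmod_closed.

Let I : zmodClosed (free_lie X) := GRing.ZmodClosed.clone _ relb _.

Definition lie_pres : Type := Quotient.quot I.

HB.instance Definition _ := GRing.Zmodule.on lie_pres.

Definition lie_pres_pi (x : free_lie X) : lie_pres := \pi_(Quotient.quot I) x.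

Lemma lie_pres_piP x y : lie_pres_pi x = lie_pres_pi y <-> lie_ideal R (x - y).
Proof.
split=> [/eqP|xy]; first by rewrite -Quotient.idealrBE => /asboolP.
by apply/eqP; rewrite -Quotient.idealrBE; apply/asboolP.
Qed.

Lemma lie_pres_pi_zmod_morphism : zmod_morphism lie_pres_pi.
Proof. exact: raddfB. Qed.

HB.instance Definition _ := GRing.isZmodMorphism.Build _ _ lie_pres_pi
  lie_pres_pi_zmod_morphism.

Lemma lie_pres_ind (P : lie_pres -> Prop) :
  (forall x, P (lie_pres_pi x)) -> forall x, P x.
Proof. by move=> Ppi x; rewrite -[x]reprK; apply: Ppi. Qed.

Let qlie (x y : lie_pres) : lie_pres := lie_pres_pi ⁅repr x, repr y⁆.

Let pi_lie x y : qlie (lie_pres_pi x) (lie_pres_pi y) = lie_pres_pi ⁅x, y⁆.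
Proof.
apply/lie_pres_piP; set x' := repr _; set y' := repr _.
have xx' : lie_ideal R (x' - x) by apply/lie_pres_piP/reprK.
have yy' : lie_ideal R (y' - y) by apply/lie_pres_piP/reprK.
rewrite (_ : _ - _ = ⁅x', y' - y⁆ - ⁅y, x' - x⁆).
  by apply: lie_idealB; apply: lie_ideal_lie.
by rewrite !lieBr (lieC y x') (lieC y x) opprB !opprK [- _ + _]addrC addrA addrNK.
Qed.

Let qlieDl : left_distributive qlie +%R.
Proof.
elim/lie_pres_ind=> x; elim/lie_pres_ind=> y; elim/lie_pres_ind=> z.
by rewrite -raddfD !pi_lie -raddfD lieDl.
Qed.
Let qlieDr : right_distributive qlie +%R.
Proof.
elim/lie_pres_ind=> x; elim/lie_pres_ind=> y; elim/lie_pres_ind=> z.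
by rewrite -raddfD !pi_lie -raddfD lieDr.
Qed.
Let qliexx x : qlie x x = 0.
Proof. by elim/lie_pres_ind: x => x; rewrite pi_lie liexx raddf0. Qed.
Let qlie_jacobi x y z :
  qlie x (qlie y z) + qlie y (qlie z x) + qlie z (qlie x y) = 0.
Proof.
elim/lie_pres_ind: x => x; elim/lie_pres_ind: y => y.
by elim/lie_pres_ind: z => z; rewrite !pi_lie -!raddfD lie_jacobi raddf0.
Qed.

HB.instance Definition _ :=
  isLieRing.Build lie_pres qlieDl qlieDr qliexx qlie_jacobi.

Lemma lie_pres_pi_lie x y :
  lie_pres_pi ⁅x, y⁆ = ⁅lie_pres_pi x, lie_pres_pi y⁆.
Proof. by rewrite -pi_lie. Qed.

Definition lie_pres_gen (x : X) : lie_pres := lie_pres_pi (free_lie_gen x).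

Lemma lie_pres_pi_morphism : lie_morphism lie_pres_pi.
Proof. by split; [exact: raddfB|exact: lie_pres_pi_lie]. Qed.

Section Lift.
Variables (M : lieRingType) (g : X -> M).
Hypothesis gR : forall r, R r -> free_lie_lift g r = 0.

Definition lie_pres_lift (x : lie_pres) : M := free_lie_lift g (repr x).

Lemma lie_pres_liftE x : lie_pres_lift (lie_pres_pi x) = free_lie_lift g x.
Proof.
have [gB gL] := free_lie_lift_morphism g.
have g0 : free_lie_lift g 0 = 0 by rewrite -(subrr 0) gB subrr.
apply/eqP; rewrite -subr_eq0 -gB; apply/eqP.
have : lie_ideal R (repr (lie_pres_pi x) - x) by apply/lie_pres_piP/reprK.
elim=> [r /gR //||y z _ yE _ zE|y z _ zE]; first exact: g0.
  by rewrite gB yE zE subrr.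
by rewrite gL zE lier0.
Qed.

Lemma lie_pres_lift_morphism : lie_morphism lie_pres_lift.
Proof.
have [gB gL] := free_lie_lift_morphism g.
split; elim/lie_pres_ind=> x; elim/lie_pres_ind=> y.
  by rewrite -raddfB !lie_pres_liftE gB.
by rewrite -lie_pres_pi_lie !lie_pres_liftE gL.
Qed.

Lemma lie_pres_lift_gen x : lie_pres_lift (lie_pres_gen x) = g x.
Proof. by rewrite lie_pres_liftE free_lie_lift_gen. Qed.

Lemma lie_pres_lift_unique (f : lie_pres -> M) :
  lie_morphism f -> (forall x, f (lie_pres_gen x) = g x) -> f =1 lie_pres_lift.
Proof.
move=> [fB fL] fg; elim/lie_pres_ind=> x; rewrite lie_pres_liftE.
apply: (@free_lie_lift_unique _ _ _ (f \o lie_pres_pi)) => //.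
by split=> y z /=; rewrite ?raddfB ?lie_pres_pi_lie ?fB ?fL.
Qed.

End Lift.

End Presentation.

(* U(L) is the unital associative ring generated by symbols iota(x), x in L,
   subject to iota(x + y) = iota(x) + iota(y) and
   iota([x, y]) = iota(x) iota(y) - iota(y) iota(x): this is the tensor ring of
   the abelian group L modulo the usual commutator relations. *)
Section EnvelopingRing.
Variable L : lieRingType.

Inductive env_term :=
| EVar of L
| EZero
| EOne
| EOpp of env_term
| EAdd of env_term & env_term
| EMul of env_term & env_term.

HB.instance Definition _ := gen_eqMixin env_term.
HB.instance Definition _ := gen_choiceMixin env_term.

Inductive env_eq : env_term -> env_term -> Prop :=
| env_refl t : env_eq t t
| env_sym t u : env_eq t u -> env_eq u t
| env_trans t u v : env_eq t u -> env_eq u v -> env_eq t v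
| env_opp t t' : env_eq t t' -> env_eq (EOpp t) (EOpp t')
| env_add t t' u u' : env_eq t t' -> env_eq u u' ->
    env_eq (EAdd t u) (EAdd t' u')
| env_mul t t' u u' : env_eq t t' -> env_eq u u' ->
    env_eq (EMul t u) (EMul t' u')
| env_addA t u v : env_eq (EAdd t (EAdd u v)) (EAdd (EAdd t u) v)
| env_addC t u : env_eq (EAdd t u) (EAdd u t)
| env_add0 t : env_eq (EAdd EZero t) t
| env_addN t : env_eq (EAdd (EOpp t) t) EZero
| env_mulA t u v : env_eq (EMul t (EMul u v)) (EMul (EMul t u) v)
| env_mul1 t : env_eq (EMul EOne t) t
| env_mulr1 t : env_eq (EMul t EOne) t
| env_mulDl t u v : env_eq (EMul (EAdd t u) v) (EAdd (EMul t v) (EMul u v))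
| env_mulDr t u v : env_eq (EMul t (EAdd u v)) (EAdd (EMul t u) (EMul t v))
| env_varD x y : env_eq (EVar (x + y)) (EAdd (EVar x) (EVar y))
| env_var_lie x y : env_eq (EVar ⁅x, y⁆)
    (EAdd (EMul (EVar x) (EVar y)) (EOpp (EMul (EVar y) (EVar x)))).

Definition env_eqb : rel env_term := fun t u => `[< env_eq t u >].

Lemma env_eqb_equiv : equiv_class_of env_eqb.
Proof.
split=> [t|t u|u t v].
- exact/asboolP/env_refl.
- by apply/asboolP/asboolP => /env_sym.
- by move=> /asboolP tu /asboolP uv; apply/asboolP; apply: env_trans tu uv.
Qed.

Canonical env_equiv := EquivRelPack env_eqb_equiv.

Definition envel : Type := {eq_quot env_eqb}.

HB.instance Definition _ : EqQuotient _ env_eqb envel := EqQuotient.on envel.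
HB.instance Definition _ := Choice.on envel.

Lemma envel_eqP t u : env_eq t u <-> \pi_envel t = \pi_envel u.
Proof.
split=> [tu|/eqP]; first by apply/eqP; rewrite piE; apply/asboolP.
by rewrite piE => /asboolP.
Qed.

Lemma envel_repr t : env_eq (repr (\pi_envel t)) t.
Proof. by apply/envel_eqP; rewrite reprK. Qed.

Let ezero : envel := \pi_envel EZero.
Let eone : envel := \pi_envel EOne.
Let eopp (x : envel) : envel := \pi_envel (EOpp (repr x)).
Let eadd (x y : envel) : envel := \pi_envel (EAdd (repr x) (repr y)).
Let emul (x y : envel) : envel := \pi_envel (EMul (repr x) (repr y)).

Let pi_opp t : eopp (\pi t) = \pi_envel (EOpp t).
Proof. exact/envel_eqP/env_opp/envel_repr. Qed.
Let pi_add t u : eadd (\pi t) (\pi u) = \pi_envel (EAdd t u).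
Proof. by apply/envel_eqP/env_add; apply: envel_repr. Qed.
Let pi_mul t u : emul (\pi t) (\pi u) = \pi_envel (EMul t u).
Proof. by apply/envel_eqP/env_mul; apply: envel_repr. Qed.

Let eaddA : associative eadd.
Proof.
by elim/quotW=> t; elim/quotW=> u; elim/quotW=> v; rewrite !pi_add;
  apply/envel_eqP/env_addA.
Qed.
Let eaddC : commutative eadd.
Proof.
by elim/quotW=> t; elim/quotW=> u; rewrite !pi_add; apply/envel_eqP/env_addC.
Qed.
Let eadd0 : left_id ezero eadd.
Proof. by elim/quotW=> t; rewrite pi_add; apply/envel_eqP/env_add0. Qed.
Let eaddN : left_inverse ezero eopp eadd.
Proof.
by elim/quotW=> t; rewrite pi_opp pi_add; apply/envel_eqP/env_addN.
Qed.

HB.instance Definition _ := GRing.isZmodule.Build envel eaddA eaddC eadd0 eaddN.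

Let emulA : associative emul.
Proof.
by elim/quotW=> t; elim/quotW=> u; elim/quotW=> v; rewrite !pi_mul;
  apply/envel_eqP/env_mulA.
Qed.
Let emul1 : left_id eone emul.
Proof. by elim/quotW=> t; rewrite pi_mul; apply/envel_eqP/env_mul1. Qed.
Let emulr1 : right_id eone emul.
Proof. by elim/quotW=> t; rewrite pi_mul; apply/envel_eqP/env_mulr1. Qed.
Let emulDl : left_distributive emul eadd.
Proof.
by elim/quotW=> t; elim/quotW=> u; elim/quotW=> v;
  rewrite pi_add !pi_mul pi_add; apply/envel_eqP/env_mulDl.
Qed.
Let emulDr : right_distributive emul eadd.
Proof.
by elim/quotW=> t; elim/quotW=> u; elim/quotW=> v;
  rewrite pi_add !pi_mul pi_add; apply/envel_eqP/env_mulDr.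
Qed.

HB.instance Definition _ :=
  GRing.Zmodule_isPzRing.Build envel emulA emul1 emulr1 emulDl emulDr.

Definition envel_iota (x : L) : envel := \pi_envel (EVar x).

Lemma envel_iotaD x y : envel_iota (x + y) = envel_iota x + envel_iota y.
Proof. by apply: etrans (esym (pi_add _ _)); apply/envel_eqP/env_varD. Qed.

Lemma envel_iota_zmod_morphism : zmod_morphism envel_iota.
Proof.
by move=> x y; apply: (addIr (envel_iota y)); rewrite -envel_iotaD !addrNK.
Qed.

HB.instance Definition _ :=
  GRing.isZmodMorphism.Build L envel envel_iota envel_iota_zmod_morphism.

Lemma envel_iota_lie x y :
  envel_iota ⁅x, y⁆ = envel_iota x * envel_iota y - envel_iota y * envel_iota x.
Proof.
rewrite -[RHS]/(eadd (emul _ _) (eopp (emul _ _))) !pi_mul pi_opp pi_add.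
exact/envel_eqP/env_var_lie.
Qed.

Lemma envel_zeroE : 0 = \pi_envel EZero. Proof. by []. Qed.
Lemma envel_oneE : 1 = \pi_envel EOne. Proof. by []. Qed.
Lemma envel_oppE t : - \pi_envel t = \pi_envel (EOpp t).
Proof. exact: pi_opp. Qed.
Lemma envel_addE t u : \pi_envel t + \pi_envel u = \pi_envel (EAdd t u).
Proof. exact: pi_add. Qed.
Lemma envel_mulE t u : \pi_envel t * \pi_envel u = \pi_envel (EMul t u).
Proof. exact: pi_mul. Qed.

Section Lift.
Variables (A : pzRingType) (g : L -> A).
Hypothesis gB : zmod_morphism g.
Hypothesis gL : forall x y, g ⁅x, y⁆ = g x * g y - g y * g x.

Fixpoint env_eval (t : env_term) : A :=
  match t with
  | EVar x => g x
  | EZero => 0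
  | EOne => 1
  | EOpp t => - env_eval t
  | EAdd t u => env_eval t + env_eval u
  | EMul t u => env_eval t * env_eval u
  end.

Lemma env_eval_eq t u : env_eq t u -> env_eval t = env_eval u.
Proof.
have g0 : g 0 = 0 by rewrite -(subrr 0) gB subrr.
have gN y : g (- y) = - g y by rewrite -sub0r gB g0 sub0r.
have gD x y : g (x + y) = g x + g y by rewrite -{1}[y]opprK gB gN opprK.
elim=> //= *; do ?congruence.
- exact: addrA.
- exact: addrC.
- exact: add0r.
- exact: addNr.
- exact: mulrA.
- exact: mul1r.
- exact: mulr1.
- exact: mulrDl.
- exact: mulrDr.
Qed.

Definition envel_lift (x : envel) : A := env_eval (repr x).

Lemma envel_liftE t : envel_lift (\pi t) = env_eval t.
Proof. exact/env_eval_eq/envel_repr. Qed.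

Lemma envel_lift_zmod_morphism : zmod_morphism envel_lift.
Proof.
elim/quotW=> t; elim/quotW=> u.
by rewrite envel_oppE envel_addE !envel_liftE.
Qed.

Lemma envel_lift_monoid_morphism : monoid_morphism envel_lift.
Proof.
split; first by rewrite envel_oneE envel_liftE.
by elim/quotW=> t; elim/quotW=> u; rewrite envel_mulE !envel_liftE.
Qed.

Lemma envel_lift_iota x : envel_lift (envel_iota x) = g x.
Proof. exact: envel_liftE. Qed.

Lemma envel_lift_unique (f : {rmorphism envel -> A}) :
  (forall x, f (envel_iota x) = g x) -> f =1 envel_lift.
Proof.
move=> fg; elim/quotW=> t; rewrite envel_liftE.
elim: t => [x|||t IH|t IHt u IHu|t IHt u IHu] /=.
- exact: fg.
- by rewrite -envel_zeroE rmorph0.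
- by rewrite -envel_oneE rmorph1.
- by rewrite -envel_oppE rmorphN IH.
- by rewrite -envel_addE rmorphD IHt IHu.
- by rewrite -envel_mulE rmorphM IHt IHu.
Qed.

End Lift.

Definition augmentation_ideal : set envel := ring_ideal (range envel_iota).

Definition lie_dimension (n : nat) : set L :=
  [set x | ideal_pow augmentation_ideal n (envel_iota x)].

End EnvelopingRing.
Arguments lie_dimension : clear implicits.

(* Main.v *)
Require Import Defs.
From mathcomp Require Import all_boot all_algebra.
From mathcomp Require Import classical_sets.
From HB Require Import structures.
From mathcomp Require Import ring zify ssrAC.

(** Write y_i = [x4, x_i].  The three relators express 4 x1, 16 x2 and 64 x3
as integral combinations of the y_i.

Membership in the dimension subring.  In the enveloping ring,
32[x1, x2] = 2 x1 (16 x2) - 8 x2 (4 x1), and 64[x1, x3] and 128[x2, x3] split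
in the same way into products to which a relator applies.  After the
substitution only multiples of the products x_i y_j are left, and in the sum a
every coefficient becomes divisible by the coefficient (4, 16 or 64) of the
relator for x_i or for x_j.  If it is the one for x_i, then a multiple of x_i
in the second power of the augmentation ideal multiplies y_j; if it is the one
for x_j, then x_i multiplies a multiple of y_j = [x4, x_j] in the third power.
Both products lie in the fourth power (commutator_sum_dimension).

Not in the lower central series.  Map the free Lie ring onto the Lie ring
witness, which is free abelian of rank 8 on images of x1, x2, x3, the
y_i, x4, and a central element c.  Its nonzero brackets of basis elements are
[x4, x_i] = y_i, the [x_i, x_j], and the [x_i, y_i], the last two kinds being
multiples of c, so that its fourth lower central term vanishes.  The multiples
are chosen so that the ideal generated by the relators meets the line of c only
in multiples of 256 c (lie_ideal_witness_relations), whereas a goes to 384 c.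
A preimage of a in the free Lie ring is, if a lies in the fourth lower central
term, congruent to an element of that term of the free Lie ring modulo the
relators, hence 384 c would be in that ideal. *)

Set Implicit Arguments.
Unset Strict Implicit.
Unset Printing Implicit Defensive.

Import GRing.Theory.
Local Open Scope ring_scope.
Local Open Scope classical_set_scope.

(** * Powers of a two-sided ideal *)

Section IdealPowers.
Variables (R : pzRingType) (S : set R).
Local Notation I := (ring_ideal S).

Lemma ideal_pow0 n : ideal_pow I n 0.
Proof. case: n => [|[|n]] //=; [exact: ring_ideal0|exact: zspan0]. Qed.

Lemma ideal_powB n x y :
  ideal_pow I n x -> ideal_pow I n y -> ideal_pow I n (x - y).
Proof. case: n => [|[|n]] //=; [exact: ring_idealB|exact: zspanB]. Qed.

Lemma ideal_powN n x : ideal_pow I n x -> ideal_pow I n (- x).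
Proof.
by move=> Ix; rewrite -sub0r; apply: ideal_powB => //; exact: ideal_pow0.
Qed.

Lemma ideal_powD n x y :
  ideal_pow I n x -> ideal_pow I n y -> ideal_pow I n (x + y).
Proof. by move=> Ix Iy; rewrite -[y]opprK; apply/ideal_powB/ideal_powN. Qed.

Lemma ideal_powMn n x k : ideal_pow I n x -> ideal_pow I n (x *+ k).
Proof.
move=> Ix; elim: k => [|k IH]; first by rewrite mulr0n; exact: ideal_pow0.
by rewrite mulrS; exact: ideal_powD.
Qed.

Lemma ideal_powM m n x y :
  ideal_pow I m.+1 x -> ideal_pow I n.+1 y -> ideal_pow I (m.+1 + n.+1) (x * y).
Proof.
move=> Ix Iy; elim: m x Ix => [x Ix|m IH x].
  by apply: zspan_mem; exists x, y.
elim=> [_ [a [b [Ia Ib ->]]]||a b _ IHa _ IHb].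
- by rewrite -mulrA; apply: zspan_mem; exists a, (b * y); split=> //; exact: IH.
- by rewrite mul0r; exact: ideal_pow0.
by rewrite mulrBl; exact: ideal_powB.
Qed.

End IdealPowers.

(** * Lie dimension subrings *)

Section Dimension.
Variable L : lieRingType.
Implicit Types (x y : L) (m n k : nat).
Local Notation iota := (@envel_iota L).
Local Notation varpi := (ideal_pow (@augmentation_ideal L)).

Lemma lie_dimension1 x : lie_dimension L 1 x.
Proof. by apply: ring_ideal_mem; exists x. Qed.

Lemma lie_dimensionB n x y :
  lie_dimension L n x -> lie_dimension L n y -> lie_dimension L n (x - y).
Proof. by rewrite /lie_dimension /mkset raddfB; exact: ideal_powB. Qed.

Lemma lie_dimensionN n x : lie_dimension L n x -> lie_dimension L n (- x).
Proof. by rewrite /lie_dimension /mkset raddfN; exact: ideal_powN. Qed.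

Lemma lie_dimensionD n x y :
  lie_dimension L n x -> lie_dimension L n y -> lie_dimension L n (x + y).
Proof. by rewrite /lie_dimension /mkset raddfD; exact: ideal_powD. Qed.

Lemma lie_dimensionMn n x k :
  lie_dimension L n x -> lie_dimension L n (x *+ k).
Proof. by rewrite /lie_dimension /mkset raddfMn; exact: ideal_powMn. Qed.

Lemma lie_dimensionM m n x y :
  lie_dimension L m.+1 x -> lie_dimension L n.+1 y ->
  varpi (m.+1 + n.+1) (iota x * iota y).
Proof. exact: ideal_powM. Qed.

Lemma lie_dimension_lie n x y :
  lie_dimension L n.+1 y -> lie_dimension L n.+2 ⁅x, y⁆.
Proof.
move=> yn; rewrite /lie_dimension /mkset envel_iota_lie; apply: ideal_powB.
  exact: (lie_dimensionM (lie_dimension1 x) yn).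
by rewrite -[n.+2]addn1; exact: (lie_dimensionM yn (lie_dimension1 x)).
Qed.

Lemma lieMnr x y n : ⁅x, y *+ n⁆ = ⁅x, y⁆ *+ n.
Proof.
by elim: n => [|n IH]; rewrite ?mulr0n ?lier0 // !mulrS lieDr IH.
Qed.

(** The two halves of a commutator absorb different factors of its
coefficient, so that a different relator can be applied in each half. *)
Lemma envel_iota_lieMn x y i j k l m : i = (j * k)%N -> i = (l * m)%N ->
  iota (⁅x, y⁆ *+ i)
  = iota x * iota (y *+ j) *+ k - iota y * iota (x *+ l) *+ m.
Proof.
move=> ijk ilm.
rewrite (raddfMn (@envel_iota L)) /= envel_iota_lie mulrnBl {1}ijk ilm.
by rewrite !(raddfMn (@envel_iota L)) /= !mulrnAr -!mulrnA.
Qed.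

(** Collects the multiples of the products x_i d_j.  The coefficients 2, 4, 8
and 16 are variables here, since rewriting would otherwise unfold the
corresponding repeated sums. *)
Lemma regroup_products (A : pzRingType) (n2 n4 n8 n16 : nat)
    (x1 x2 x3 d1 d2 d3 : A) :
  (x1 * (d1 - d3 *+ n4) *+ n2 + x2 * (d3 *+ n2 + d2) *+ n8)
  + (x1 * (d2 *+ n4 + d1 *+ n2) + x3 * (d3 *+ n2 + d2) *+ n16)
  + (x2 * (d2 *+ n4 + d1 *+ n2) *+ n2 - x3 * (d1 - d3 *+ n4) *+ n8)
  = x1 * d1 *+ (n2 + n2) + x2 * d2 *+ (n8 + n4 * n2)
    + x3 * d3 *+ (n2 * n16 + n4 * n8) + x2 * d1 *+ (n2 * n2)
    + x2 * d3 *+ (n2 * n8) + x1 * d2 *+ n4 + x3 * d2 *+ n16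
    - x1 * d3 *+ (n4 * n2) - x3 * d1 *+ n8.
Proof.
rewrite !mulrBr !mulrDr !mulrnAr !mulrnBl !mulrnDl -!mulrnA opprB !mulrnDr.
by rewrite !addrA [LHS](ACl (1*6*4*9*7*11*10*3*5*8*2*12)).
Qed.

Lemma commutator_sum_dimension x1 x2 x3 x4 :
  x1 *+ 4 + ⁅x4, x3⁆ *+ 2 + ⁅x4, x2⁆ = 0 ->
  x2 *+ 16 + ⁅x4, x3⁆ *+ 4 - ⁅x4, x1⁆ = 0 ->
  x3 *+ 64 - ⁅x4, x2⁆ *+ 4 - ⁅x4, x1⁆ *+ 2 = 0 ->
  lie_dimension L 4
    (⁅x1, x2⁆ *+ 32 + ⁅x1, x3⁆ *+ 64 + ⁅x2, x3⁆ *+ 128).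
Proof.
set d1 := ⁅x4, x1⁆; set d2 := ⁅x4, x2⁆; set d3 := ⁅x4, x3⁆ => r1 r2 r3.
have x1E : x1 *+ 4 = - (d3 *+ 2 + d2) by apply/eqP; rewrite -addr_eq0 addrA r1.
have x2E : x2 *+ 16 = d1 - d3 *+ 4 by rewrite -(subr0_eq r2) addrK.
have x3E : x3 *+ 64 = d2 *+ 4 + d1 *+ 2 by rewrite -(subr0_eq r3) addrC subrK.
have dim2 x : lie_dimension L 2 ⁅x4, x⁆.
  exact/lie_dimension_lie/lie_dimension1.
have dim2Mn x k : lie_dimension L 2 (⁅x4, x⁆ *+ k).
  exact: lie_dimensionMn.
have x1_dim : lie_dimension L 2 (x1 *+ 4).
  by rewrite x1E; exact/lie_dimensionN/(lie_dimensionD (dim2Mn x3 2) (dim2 x2)).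
have x2_dim : lie_dimension L 2 (x2 *+ 16).
  by rewrite x2E; exact: lie_dimensionB (dim2 x1) (dim2Mn x3 4).
have x3_dim : lie_dimension L 2 (x3 *+ 64).
  by rewrite x3E; exact: lie_dimensionD (dim2Mn x2 4) (dim2Mn x1 2).
have mul_dimL x y k l :
    lie_dimension L 2 (x *+ k) -> varpi 4 (iota x * iota ⁅x4, y⁆ *+ (k * l)).
  move=> xk; rewrite mulrnA -mulrnAl -(raddfMn (@envel_iota L)).
  by apply: ideal_powMn; exact: (@lie_dimensionM 1 1).
have mul_dimR x y k l :
    lie_dimension L 2 (y *+ k) -> varpi 4 (iota x * iota ⁅x4, y⁆ *+ (k * l)).
  move=> yk; rewrite mulrnA -mulrnAr -(raddfMn (@envel_iota L)) -lieMnr.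
  apply: ideal_powMn; apply: (@lie_dimensionM 0 2).
    exact: lie_dimension1.
  exact: lie_dimension_lie.
have X1E : iota (x1 *+ 4) = - (iota d3 *+ 2 + iota d2).
  by rewrite x1E raddfN /= envel_iotaD raddfMn.
have X2E : iota (x2 *+ 16) = iota d1 - iota d3 *+ 4.
  by rewrite x2E raddfB /= raddfMn.
have X3E : iota (x3 *+ 64) = iota d2 *+ 4 + iota d1 *+ 2.
  by rewrite x3E envel_iotaD !(raddfMn (@envel_iota L)).
(* The relators have the coefficients 4, 16 and 64 on x1, x2 and x3; the factors
   32 = 16 * 2 = 4 * 8, 64 = 64 * 1 = 4 * 16 and 128 = 64 * 2 = 16 * 8 leave one
   relator to apply in each product. *)
rewrite /lie_dimension /mkset.
rewrite 2!envel_iotaD (@envel_iota_lieMn x1 x2 32 16 2 4 8) //.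
rewrite (@envel_iota_lieMn x1 x3 64 64 1 4 16) //.
rewrite (@envel_iota_lieMn x2 x3 128 64 2 16 8) //.
rewrite X1E X2E X3E !mulrN !mulNrn !opprK mulr1n (regroup_products 2 4 8 16).
(* Each coefficient is now a multiple k * l, with k the coefficient of x_i or of
   x_j in its relator. *)
apply: ideal_powB; last exact: (mul_dimR x3 x1 4 2 x1_dim).
apply: ideal_powB; last exact: (mul_dimL x1 x3 4 2 x1_dim).
apply: ideal_powD; last exact: (mul_dimR x3 x2 16 1 x2_dim).
apply: ideal_powD; last exact: (mul_dimL x1 x2 4 1 x1_dim).
apply: ideal_powD; last exact: (mul_dimL x2 x3 16 1 x2_dim).
apply: ideal_powD; last exact: (mul_dimR x2 x1 4 1 x1_dim).
apply: ideal_powD; last exact: (mul_dimR x3 x3 64 1 x3_dim).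
apply: ideal_powD; last exact: (mul_dimR x2 x2 16 1 x2_dim).
exact: (mul_dimR x1 x1 4 1 x1_dim).
Qed.

End Dimension.

(** * Morphisms, relators and the lower central series *)

Section LieMorphism.
Variables (L M : lieRingType) (f : L -> M).
Hypothesis fL : lie_morphism f.

Let fB : zmod_morphism f := fL.1.
Let f0 : f 0 = 0. Proof. by rewrite -(subrr 0) fB subrr. Qed.

Lemma lie_morphism_lower_central n x :
  lower_central L n x -> lower_central M n (f x).
Proof.
case: n => // n; elim: n x => // n IH x.
elim=> [_ [y [z [zn ->]]]||y z _ IHy _ IHz].
- by apply: zspan_mem; exists (f y), (f z); split; [exact: IH|exact: fL.2].
- by rewrite f0; exact: zspan0.
by rewrite fB; exact: zspanB.
Qed.

Lemma lie_morphism_ideal (S : set L) x :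
  lie_ideal S x -> lie_ideal (f @` S) (f x).
Proof.
elim=> [y Sy||y z _ IHy _ IHz|y z _ IHz].
- by apply: lie_ideal_mem; exists y.
- by rewrite f0; exact: lie_ideal0.
- by rewrite fB; exact: lie_idealB.
by rewrite fL.2; exact: lie_ideal_lie.
Qed.

End LieMorphism.

Lemma lie_pres_lower_central (X : Type) (R : set (free_lie X)) n x :
  lower_central (lie_pres R) n x ->
  exists2 y, lower_central (free_lie X) n y & lie_pres_pi R y = x.
Proof.
case: n => [|n]; first by elim/lie_pres_ind: x => x _; exists x.
elim: n x => [x _|n IH x]; first by elim/lie_pres_ind: x => x; exists x.
elim=> [_ [y [z [/IH [z' z'n <-] ->]]]||y z _ [y' y'n <-] _ [z' z'n <-]].
- elim/lie_pres_ind: y => y; exists ⁅y, z'⁆; last by rewrite lie_pres_pi_lie.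
  by apply: zspan_mem; exists y, z'.
- by exists 0; [exact: zspan0 | rewrite raddf0].
by exists (y' - z'); [exact: zspanB | rewrite raddfB].
Qed.

(** A test for the lower central terms of a presented Lie ring that takes place
in M, without forming the quotient of M by the images of the relators. *)
Lemma lie_pres_lower_central_image (X : Type) (R : set (free_lie X))
    (M : lieRingType) (f : free_lie X -> M) n x :
  lie_morphism f -> (forall u, lower_central M n u -> u = 0) ->
  lower_central (lie_pres R) n (lie_pres_pi R x) -> lie_ideal (f @` R) (f x).
Proof.
move=> fL Mn /lie_pres_lower_central [y yn /esym/lie_pres_piP xy].
have := lie_morphism_ideal fL xy.
by rewrite fL.1 (Mn (f y)) ?subr0 //; exact: (lie_morphism_lower_central fL).
Qed.

(** * Integral triples *)

Local Notation triple := (int * int * int)%type.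

Lemma triple_eq (a b c a' b' c' : int) :
  a = a' -> b = b' -> c = c' -> (a, b, c) = (a', b', c').
Proof. by move=> -> -> ->. Qed.

Lemma tripleD (a b c a' b' c' : int) :
  (a, b, c) + (a', b', c') = (a + a', b + b', c + c') :> triple.
Proof. by []. Qed.

Lemma tripleN (a b c : int) : - (a, b, c) = (- a, - b, - c) :> triple.
Proof. by []. Qed.

Lemma tripleMz (a b c s : int) :
  (a, b, c) *~ s = (s * a, s * b, s * c) :> triple.
Proof.
have nat_mul n : (a, b, c) *+ n = (n%:Z * a, n%:Z * b, n%:Z * c) :> triple.
  elim: n => [|n IH]; first by rewrite mulr0n !mul0r.
  by rewrite mulrS IH tripleD !intS !mulrDl !mul1r.
case: s => n; first by rewrite -pmulrn nat_mul.
by rewrite NegzE mulrNz -pmulrn nat_mul tripleN !mulNr.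
Qed.

Definition tripleE := (tripleD, tripleN, tripleMz).

(** The coefficient of c in the bracket of sum p_i x_i and sum q_i x_i; the
values 4, 2, 1 are those that alt3_diag3 forces once sym3 has been chosen. *)
Definition alt3 (p q : triple) : int :=
  let: (p1, p2, p3) := p in let: (q1, q2, q3) := q in
  4 * (p1 * q2 - p2 * q1) + 2 * (p1 * q3 - p3 * q1) + (p2 * q3 - p3 * q2).

(** The coefficient of c in the bracket of sum p_i x_i and sum q_i y_i; the
products of 64, 16, 4 with the coefficients 4, 16, 64 of the relators are all
equal to 256. *)
Definition sym3 (p q : triple) : int :=
  let: (p1, p2, p3) := p in let: (q1, q2, q3) := q in
  64 * (p1 * q1) + 16 * (p2 * q2) + 4 * (p3 * q3).

Definition dot3 (p q : triple) : int :=
  let: (p1, p2, p3) := p in let: (q1, q2, q3) := q in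
  p1 * q1 + p2 * q2 + p3 * q3.

(** The coordinates along the x_i of the combination of the three relators with
coefficients n. *)
Definition diag3 (n : triple) : triple :=
  let: (n1, n2, n3) := n in (4 * n1, 16 * n2, 64 * n3).

(** The coordinates of the same combination along the y_i. *)
Definition tail3 (n : triple) : triple :=
  let: (n1, n2, n3) := n in
  (- n2 - 2 * n3, n1 - 4 * n3, 2 * n1 + 4 * n2).

Ltac by_coordinates :=
  do ![case=> [[? ?] ?]|move=> ?];
  rewrite ?tripleE /=; try apply: triple_eq; ring.

Lemma alt3Dl p p' q : alt3 (p + p') q = alt3 p q + alt3 p' q.
Proof. move: p p' q; by_coordinates. Qed.

Lemma alt3Dr p q q' : alt3 p (q + q') = alt3 p q + alt3 p q'.
Proof. move: p q q'; by_coordinates. Qed.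

Lemma alt3xx p : alt3 p p = 0.
Proof. move: p; by_coordinates. Qed.

Lemma alt30 p : alt3 p 0 = 0.
Proof. move: p; by_coordinates. Qed.

Lemma sym3C p q : sym3 p q = sym3 q p.
Proof. move: p q; by_coordinates. Qed.

Lemma sym3D p q q' : sym3 p (q + q') = sym3 p q + sym3 p q'.
Proof. move: p q q'; by_coordinates. Qed.

Lemma sym3Mz p q s : sym3 p (q *~ s) = s * sym3 p q.
Proof. move: p q s; by_coordinates. Qed.

Lemma sym30 p : sym3 p 0 = 0.
Proof. move: p; by_coordinates. Qed.

Lemma diag3D m n : diag3 (m + n) = diag3 m + diag3 n.
Proof. move: m n; by_coordinates. Qed.

Lemma diag3N n : diag3 (- n) = - diag3 n.
Proof. move: n; by_coordinates. Qed.

Lemma diag3Mz n s : diag3 (n *~ s) = diag3 n *~ s.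
Proof. move: n s; by_coordinates. Qed.

Lemma tail3D m n : tail3 (m + n) = tail3 m + tail3 n.
Proof. move: m n; by_coordinates. Qed.

Lemma tail3N n : tail3 (- n) = - tail3 n.
Proof. move: n; by_coordinates. Qed.

Lemma sym3_diag3 p n : sym3 p (diag3 n) = 256 * dot3 p n.
Proof. move: p n; by_coordinates. Qed.

(** In the Lie ring built below, this says that x1, x2 and x3 commute with the
relators, which is what ties the coefficients of alt3 to those of sym3. *)
Lemma alt3_diag3 p n : alt3 p (diag3 n) + sym3 p (tail3 n) = 0.
Proof. move: p n; by_coordinates. Qed.

(** * A nilpotent Lie ring of rank eight *)

(** (p, q, s, t) stands for sum p_i x_i + sum q_i y_i + s x4 + t c. *)
Definition witness : Type := (triple * triple * int * int)%type.

HB.instance Definition _ := GRing.Zmodule.on witness.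

Lemma witness_eq (p q p' q' : triple) (s t s' t' : int) :
  p = p' -> q = q' -> s = s' -> t = t' ->
  (p, q, s, t) = (p', q', s', t') :> witness.
Proof. by move=> -> -> -> ->. Qed.

Lemma witnessD (p q p' q' : triple) (s t s' t' : int) :
  (p, q, s, t) + (p', q', s', t')
  = (p + p', q + q', s + s', t + t') :> witness.
Proof. by []. Qed.

Lemma witnessN (p q : triple) (s t : int) :
  - (p, q, s, t) = (- p, - q, - s, - t) :> witness.
Proof. by []. Qed.

Definition witness_lie (u v : witness) : witness :=
  let: (p, q, s, _) := u in let: (p', q', s', _) := v in
  (0, p' *~ s - p *~ s', 0, alt3 p p' + sym3 p q' - sym3 p' q).

Lemma witness_lie_tuple (p q p' q' : triple) (s t s' t' : int) :
  witness_lie (p, q, s, t) (p', q', s', t')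
  = (0, p' *~ s - p *~ s', 0, alt3 p p' + sym3 p q' - sym3 p' q).
Proof. by []. Qed.

Lemma witness_lieDl : left_distributive witness_lie +%R.
Proof.
move=> [[[p q] s] t] [[[p' q'] s'] t'] [[[p'' q''] s''] t''].
rewrite !(witnessD, witness_lie_tuple) addr0; apply: witness_eq => //.
  by rewrite mulrzDr mulrzDl opprD addrACA.
by rewrite alt3Dl sym3D !(sym3C (p + p')) sym3D !(sym3C q''); ring.
Qed.

Lemma witness_lieDr : right_distributive witness_lie +%R.
Proof.
move=> [[[p q] s] t] [[[p' q'] s'] t'] [[[p'' q''] s''] t''].
rewrite !(witnessD, witness_lie_tuple) addr0; apply: witness_eq => //.
  by rewrite mulrzDl mulrzDr opprD addrACA.
by rewrite alt3Dr sym3D !(sym3C (p' + p'')) sym3D !(sym3C q); ring.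
Qed.

Lemma witness_liexx u : witness_lie u u = 0.
Proof.
case: u => [[[p q] s] t]; rewrite witness_lie_tuple.
by apply: witness_eq; rewrite // ?subrr // alt3xx; ring.
Qed.

Lemma witnessD3 (p q p' q' p'' q'' : triple) (s t s' t' s'' t'' : int) :
  (p, q, s, t) + (p', q', s', t') + (p'', q'', s'', t'')
  = (p + p' + p'', q + q' + q'', s + s' + s'', t + t' + t'') :> witness.
Proof. by []. Qed.

(** Only double brackets of x4, x_i and x_j are in question, and for those the
identity amounts to the symmetry of sym3: ad x4 is a derivation. *)
Lemma witness_jacobi u v w :
  witness_lie u (witness_lie v w) + witness_lie v (witness_lie w u)
    + witness_lie w (witness_lie u v) = 0.
Proof.
move: u v w => [[[p q] s] t] [[[p' q'] s'] t'] [[[p'' q''] s''] t''].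
rewrite !witness_lie_tuple witnessD3; apply: (@witness_eq _ _ 0 0 _ _ 0 0).
- by rewrite !addr0.
- by rewrite !mulr0z !mul0rz subr0 !addr0.
- by rewrite !addr0.
rewrite -!mulrNz !alt30 !(sym3C 0) !sym30 !sym3D.
rewrite !sym3Mz (sym3C p' p) (sym3C p'' p) (sym3C p'' p'); ring.
Qed.

HB.instance Definition _ := isLieRing.Build witness
  witness_lieDl witness_lieDr witness_liexx witness_jacobi.

Lemma witness_lieE (p q p' q' : triple) (s t s' t' : int) :
  ⁅((p, q, s, t) : witness), ((p', q', s', t') : witness)⁆
  = (0, p' *~ s - p *~ s', 0, alt3 p p' + sym3 p q' - sym3 p' q) :> witness.
Proof. by []. Qed.

Lemma witness_lower_central2 (u : witness) :
  lower_central witness 2 u -> exists q t, u = (0, q, 0, t).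
Proof.
elim=> [_ [[[[p q] s] t] [[[[p' q'] s'] t'] [_ ->]]]||x y _ [q [t ->]] _].
- by rewrite witness_lieE; do 2 eexists.
- by exists 0, 0.
by move=> [q' [t' ->]]; exists (q - q'), (t - t').
Qed.

Lemma witness_lower_central3 (u : witness) :
  lower_central witness 3 u -> exists t, u = (0, 0, 0, t).
Proof.
elim=> [_ [[[[p q] s] t] [_ [/witness_lower_central2 [q' [t' ->]] ->]]]||].
- by rewrite witness_lieE mul0rz mulr0z subrr; eexists.
- by exists 0.
by move=> x y _ [t ->] _ [t' ->]; exists (t - t').
Qed.

Lemma witness_lower_central4 (u : witness) :
  lower_central witness 4 u -> u = 0.
Proof.
elim=> [_ [[[[p q] s] t] [_ [/witness_lower_central3 [t' ->] ->]]]
       ||x y _ -> _ ->] //.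
by rewrite witness_lieE mul0rz mulr0z subrr alt30 sym30 sym3C sym30.
Qed.

(** The span of the relators, of 4 y1, 16 y2, 64 y3 (their brackets with x4),
and of 256 c. *)
Definition witness_relations : set witness :=
  [set u | exists n m k, u = (diag3 n, tail3 n + diag3 m, 0, 256 * k)].

Lemma lie_ideal_witness_relations (S : set witness) :
  S `<=` witness_relations -> lie_ideal S `<=` witness_relations.
Proof.
move=> SJ u; elim=> [v /SJ //|||].
- by exists 0, 0, 0.
- move=> v w _ [n [m [k ->]]] _ [n' [m' [k' ->]]].
  exists (n - n'), (m - m'), (k - k').
  rewrite witnessN witnessD !diag3D !diag3N tail3D tail3N.
  by apply: witness_eq => //; [rewrite opprD addrACA | ring].
move=> [[[p q] s] t] w _ [n [m [k ->]]].
exists 0, (n *~ s), (dot3 p m - dot3 q n).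
rewrite witness_lieE; apply: witness_eq => //.
  by rewrite mulr0z subr0 diag3Mz add0r.
rewrite sym3D addrA alt3_diag3 (sym3C (diag3 n)) !sym3_diag3; ring.
Qed.

Definition witness_gen (i : 'I_4) : witness :=
  match val i with
  | 0 => ((1, 0, 0), 0, 0, 0)
  | 1 => ((0, 1, 0), 0, 0, 0)
  | 2 => ((0, 0, 1), 0, 0, 0)
  | _ => (0, 0, 1, 0)
  end.

Definition witness_map : free_lie 'I_4 -> witness := free_lie_lift witness_gen.

HB.instance Definition _ := GRing.isZmodMorphism.Build _ _ witness_map
  (free_lie_lift_morphism witness_gen).1.

Lemma witness_mapD x y : witness_map (x + y) = witness_map x + witness_map y.
Proof. exact: raddfD. Qed.

Lemma witness_mapN x : witness_map (- x) = - witness_map x.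
Proof. exact: raddfN. Qed.

Lemma witness_mapMn x n : witness_map (x *+ n) = witness_map x *+ n.
Proof. exact: raddfMn. Qed.

Lemma witness_map_lie x y :
  witness_map ⁅x, y⁆ = ⁅witness_map x, witness_map y⁆.
Proof. exact: (free_lie_lift_morphism witness_gen).2. Qed.

Lemma witness_map_gen i : witness_map (free_lie_gen i) = witness_gen i.
Proof. exact: free_lie_lift_gen. Qed.

(** * The element a *)

Theorem theorem4p12 :
  let f1 : free_lie 'I_4 := free_lie_gen (@Ordinal 4 0 isT) in
  let f2 : free_lie 'I_4 := free_lie_gen (@Ordinal 4 1 isT) in
  let f3 : free_lie 'I_4 := free_lie_gen (@Ordinal 4 2 isT) in
  let f4 : free_lie 'I_4 := free_lie_gen (@Ordinal 4 3 isT) in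
  let R : set (free_lie 'I_4) :=
    [set f1 *+ 4 + ⁅f4, f3⁆ *+ 2 + ⁅f4, f2⁆;
         f2 *+ 16 + ⁅f4, f3⁆ *+ 4 - ⁅f4, f1⁆;
         f3 *+ 64 - ⁅f4, f2⁆ *+ 4 - ⁅f4, f1⁆ *+ 2] in
  let L : lieRingType := lie_pres R in
  let x1 : L := lie_pres_gen R (@Ordinal 4 0 isT) in
  let x2 : L := lie_pres_gen R (@Ordinal 4 1 isT) in
  let x3 : L := lie_pres_gen R (@Ordinal 4 2 isT) in
  let a : L := ⁅x1, x2⁆ *+ 32 + ⁅x1, x3⁆ *+ 64 + ⁅x2, x3⁆ *+ 128 in
  (lie_dimension L 4 `\` lower_central L 4) a.
Proof.
move=> f1 f2 f3 f4 R L x1 x2 x3 a.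
pose x4 : L := lie_pres_gen R (@Ordinal 4 3 isT).
have piD u v : lie_pres_pi R (u + v) = lie_pres_pi R u + lie_pres_pi R v.
  exact: raddfD.
have piB u v : lie_pres_pi R (u - v) = lie_pres_pi R u - lie_pres_pi R v.
  exact: raddfB.
have piMn u n : lie_pres_pi R (u *+ n) = lie_pres_pi R u *+ n.
  exact: raddfMn.
have relator r : R r -> lie_pres_pi R r = 0.
  move=> Rr; rewrite -(raddf0 (lie_pres_pi R)); apply/lie_pres_piP.
  by rewrite subr0; exact: lie_ideal_mem.
split.
  apply: (@commutator_sum_dimension L x1 x2 x3 x4).
  - have := relator _ (or_introl (or_introl erefl)).
    by rewrite 2!piD 2!piMn !lie_pres_pi_lie.
  - have := relator _ (or_introl (or_intror erefl)).
    by rewrite piB piD 2!piMn !lie_pres_pi_lie.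
  have := relator _ (or_intror erefl).
  by rewrite 2!piB 3!piMn !lie_pres_pi_lie.
pose a' := ⁅f1, f2⁆ *+ 32 + ⁅f1, f3⁆ *+ 64 + ⁅f2, f3⁆ *+ 128.
have -> : a = lie_pres_pi R a' by rewrite 2!piD 3!piMn !lie_pres_pi_lie.
move=> /(lie_pres_lower_central_image (free_lie_lift_morphism witness_gen)
  witness_lower_central4).
move=> /lie_ideal_witness_relations.
have mapR : [set witness_map r | r in R] `<=` witness_relations.
  move=> _ [r rR <-]; case: rR => [[->|->]|->].
  - rewrite 2!witness_mapD 2!witness_mapMn !witness_map_lie !witness_map_gen.
    by exists (1, 0, 0), 0, 0; vm_compute.
  - rewrite witness_mapD witness_mapN witness_mapD 2!witness_mapMn.
    rewrite !witness_map_lie !witness_map_gen.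
    by exists (0, 1, 0), 0, 0; vm_compute.
  rewrite witness_mapD witness_mapN witness_mapD witness_mapN 3!witness_mapMn.
  rewrite !witness_map_lie !witness_map_gen.
  by exists (0, 0, 1), 0, 0; vm_compute.
move=> /(_ mapR); have -> : free_lie_lift witness_gen a' = (0, 0, 0, 384).
  rewrite -/witness_map 2!witness_mapD 3!witness_mapMn !witness_map_lie.
  by rewrite !witness_map_gen; vm_compute.
by move=> [n [m [k /(congr1 snd) /=]]]; lia.
Qed.
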